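(* Let $U$ be a group on which $SL(2,\mathbb{Z})$ acts from the left by group automorphisms $u\mapsto g[u]$, let $U_+$ be the subgroup of elements fixed by $-I$, and let $M_U(SL(2,\mathbb{Z}))$ be the set of $U$-valued pseudo-measures $J$ that are modular, i.e. $J(g\alpha,g\beta)=g[J(\alpha,\beta)]$ for all $g\in SL(2,\mathbb{Z})$, $\alpha,\beta\in\mathbf{P}^1(\mathbb{Q})$. Define $\varphi:U_+\to U_+\times U_+$ by $\varphi(u)=(\sigma[u]\cdot u,\ \tau^2[u]\cdot\tau[u]\cdot u)$. Then $J\mapsto J(\infty,0)$ is a bijection $M_U(SL(2,\mathbb{Z}))\cong\varphi^{-1}(1_U,1_U)$.
   Context: $\mathbf{P}^1(\mathbb{Q})=\mathbb{Q}\cup\{\infty\}$ with fractional linear action. A $U$-valued pseudo-measure is a function $J:\mathbf{P}^1(\mathbb{Q})^2\to U$ with $J(\alpha,\alpha)=1$, $J(\beta,\alpha)J(\alpha,\beta)=1$, $J(\gamma,\alpha)J(\beta,\gamma)J(\alpha,\beta)=1$ for all $\alpha,\beta,\gamma$ (here $J(\alpha,\beta)$ is the value on the segment with ingoing end $\alpha$ and outgoing end $\beta$). $\sigma=\begin{pmatrix}0&-1\\1&0\end{pmatrix}$, $\tau=\begin{pmatrix}0&-1\\1&-1\end{pmatrix}$; $U_+$ is regarded as a $PSL(2,\mathbb{Z})$-group. *)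

(* Defs.v *)
From HB Require Import structures.
From mathcomp Require Import all_boot all_order all_algebra.
From mathcomp Require Import boolp classical_sets functions.

Set Implicit Arguments.
Unset Strict Implicit.
Unset Printing Implicit Defensive.

Import GRing.Theory.

Local Open Scope ring_scope.

Definition mx2 (R : Type) (a b c d : R) : 'M[R]_2 :=
  \matrix_(i, j) if i == 0 then if j == 0 then a else b
                 else if j == 0 then c else d.

Record SL2Z := MkSL2Z { SL2Z_mx :> 'M[int]_2; _ : \det SL2Z_mx == 1 }.

HB.instance Definition _ := [isSub for SL2Z_mx].
HB.instance Definition _ := [Choice of SL2Z by <:].

Lemma SL2Z_det (g : SL2Z) : \det g = 1.
Proof. exact/eqP/(valP g). Qed.

Fact SL2Z_one_subproof : \det (1%:M : 'M[int]_2) == 1.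
Proof. by rewrite det1. Qed.

Fact SL2Z_mul_subproof (g h : SL2Z) : \det (g *m h) == 1.
Proof. by rewrite det_mulmx !SL2Z_det mulr1. Qed.

Fact SL2Z_inv_subproof (g : SL2Z) : \det (\adj g) == 1.
Proof.
have := congr1 (@determinant _ _) (mul_mx_adj (SL2Z_mx g)).
by rewrite det_mulmx SL2Z_det mul1r det1 => ->.
Qed.

Definition SL2Z_one := MkSL2Z SL2Z_one_subproof.
Definition SL2Z_mul (g h : SL2Z) := MkSL2Z (SL2Z_mul_subproof g h).
Definition SL2Z_inv (g : SL2Z) := MkSL2Z (SL2Z_inv_subproof g).

Fact SL2Z_mulgA : associative SL2Z_mul.
Proof. by move=> g h k; apply/val_inj; rewrite /= mulmxA. Qed.
Fact SL2Z_mul1g : left_id SL2Z_one SL2Z_mul.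
Proof. by move=> g; apply/val_inj; rewrite /= mul1mx. Qed.
Fact SL2Z_mulg1 : right_id SL2Z_one SL2Z_mul.
Proof. by move=> g; apply/val_inj; rewrite /= mulmx1. Qed.
Fact SL2Z_mulVg : left_inverse SL2Z_one SL2Z_inv SL2Z_mul.
Proof. by move=> g; apply/val_inj; rewrite /= mul_adj_mx SL2Z_det. Qed.
Fact SL2Z_mulgV : right_inverse SL2Z_one SL2Z_inv SL2Z_mul.
Proof. by move=> g; apply/val_inj; rewrite /= mul_mx_adj SL2Z_det. Qed.

HB.instance Definition _ := isGroup.Build SL2Z
  SL2Z_mulgA SL2Z_mul1g SL2Z_mulg1 SL2Z_mulVg SL2Z_mulgV.

Lemma det_mx2 (R : comPzRingType) (a b c d : R) :
  \det (mx2 a b c d) = a * d - b * c.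
Proof.
rewrite (expand_det_row _ ord0) !big_ord_recl big_ord0 /cofactor !det_mx11.
by rewrite !mxE /= expr0 expr1 mul1r mulN1r mulrN addr0.
Qed.

Fact sigma_subproof : \det (mx2 0 (- 1) 1 0 : 'M[int]_2) == 1.
Proof. by rewrite det_mx2. Qed.
Fact tau_subproof : \det (mx2 0 (- 1) 1 (- 1) : 'M[int]_2) == 1.
Proof. by rewrite det_mx2. Qed.
Fact minusI_subproof : \det (mx2 (- 1) 0 0 (- 1) : 'M[int]_2) == 1.
Proof. by rewrite det_mx2. Qed.

Definition sigma : SL2Z := MkSL2Z sigma_subproof.
Definition tau : SL2Z := MkSL2Z tau_subproof.
Definition minusI : SL2Z := MkSL2Z minusI_subproof.

(* [None] is the point at infinity. *)
Definition P1Q := option rat.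
Definition infty : P1Q := None.
Definition P1Q_of_rat (x : rat) : P1Q := Some x.

Definition P1Q_ratio (p q : rat) : P1Q :=
  if q == 0 then infty else P1Q_of_rat (p / q).

Definition moebius (g : SL2Z) (x : P1Q) : P1Q :=
  let a : rat := (g 0 0)%:~R in let b : rat := (g 0 1)%:~R in
  let c : rat := (g 1 0)%:~R in let d : rat := (g 1 1)%:~R in
  if x is Some t then P1Q_ratio (a * t + b) (c * t + d) else P1Q_ratio a c.

(* Left actions of G on the group U by group automorphisms; that each
   [gact g] is bijective follows from [gact1] and [gactM]. *)
Record group_action (G U : groupType) := GroupAction {
  gact :> G -> U -> U;
  gact1 : forall u, gact 1%g u = u;
  gactM : forall g h u, gact (g * h)%g u = gact g (gact h u);
  gact_morph : forall g, {morph gact g : u v / (u * v)%g} }.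

Section FixedSubgroup.
Variables (U : groupType) (act : group_action SL2Z U).

Definition fix_minusI : {pred U} := [pred u | act minusI u == u].

Lemma fix_minusIP u : reflect (act minusI u = u) (u \in fix_minusI).
Proof. exact: eqP. Qed.

Lemma gact_g1 (g : SL2Z) : act g 1%g = 1%g.
Proof. by apply: (mulgI (act g 1%g)); rewrite -gact_morph !mulg1. Qed.

Lemma gactV (g : SL2Z) u : act g (u^-1)%g = ((act g u)^-1)%g.
Proof. by apply: (mulgI (act g u)); rewrite -gact_morph !mulgV gact_g1. Qed.

Fact fix_minusI_group_closed : group_closed fix_minusI.
Proof.
split=> [|u v /fix_minusIP uP /fix_minusIP vP]; apply/fix_minusIP.
  exact: gact_g1.
by rewrite gact_morph gactV uP vP.
Qed.

Record U_plus := MkUPlus { U_plus_val :> U; _ : U_plus_val \in fix_minusI }.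

HB.instance Definition _ := [isSub for U_plus_val].
HB.instance Definition _ := [Choice of U_plus by <:].
HB.instance Definition _ :=
  SubChoice_isSubGroup.Build U fix_minusI U_plus fix_minusI_group_closed.

Lemma minusI_central (g : SL2Z) : (minusI * g = g * minusI)%g.
Proof.
have minusIE : SL2Z_mx minusI = (- 1)%:M.
  by apply/matrixP => i j; rewrite !mxE; case: i => [[|[|i]] ?] //; case: j => [[|[|j]] ?].
by apply/val_inj; rewrite /= -[mx2 _ _ _ _]/(SL2Z_mx minusI) minusIE scalar_mxC.
Qed.

Fact gact_plus_subproof (g : SL2Z) (u : U_plus) :
  act g (val u) \in fix_minusI.
Proof.
by apply/fix_minusIP; rewrite -gactM minusI_central gactM (fix_minusIP _ (valP u)).
Qed.

Definition gact_plus_fun (g : SL2Z) (u : U_plus) : U_plus :=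
  MkUPlus (gact_plus_subproof g u).

Fact gact_plus1 u : gact_plus_fun 1%g u = u.
Proof. by apply/val_inj; rewrite /= gact1. Qed.
Fact gact_plusM g h u :
  gact_plus_fun (g * h)%g u = gact_plus_fun g (gact_plus_fun h u).
Proof. by apply/val_inj; rewrite /= gactM. Qed.
Fact gact_plus_morph g : {morph gact_plus_fun g : u v / (u * v)%g}.
Proof. by move=> u v; apply/val_inj; exact: gact_morph. Qed.

Definition gact_plus : group_action SL2Z U_plus :=
  GroupAction gact_plus1 gact_plusM gact_plus_morph.

(* [gact_plus] factors through PSL(2, Z), so that [sigma] and [tau] act on
   [U_plus] as their classes in PSL(2, Z) do. *)
Lemma gact_plus_minusI u : gact_plus minusI u = u.
Proof. by apply/val_inj/fix_minusIP/(valP u). Qed.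

Definition phi (u : U_plus) : U_plus * U_plus :=
  (gact_plus sigma u * u, gact_plus (tau ^+ 2) u * gact_plus tau u * u)%g.

End FixedSubgroup.

Arguments phi {U} act u.

(* [J a b] is the value on the segment with ingoing end [a] and outgoing end
   [b]. *)
Definition pseudo_measure (U : groupType) (J : P1Q -> P1Q -> U) : Prop :=
  [/\ forall a, J a a = 1%g,
      forall a b, (J b a * J a b)%g = 1%g &
      forall a b c, (J c a * J b c * J a b)%g = 1%g].

Definition modular (U : groupType) (act : group_action SL2Z U)
    (J : P1Q -> P1Q -> U) : Prop :=
  forall (g : SL2Z) (a b : P1Q),
    J (moebius g a) (moebius g b) = act g (J a b).

Definition modular_pseudo_measures (U : groupType)
    (act : group_action SL2Z U) : set (P1Q -> P1Q -> U) :=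
  [set J | pseudo_measure J /\ modular act J]%classic.

(* Main.v *)
Require Import Defs.
From mathcomp Require Import all_boot all_order all_algebra.
From mathcomp Require Import boolp classical_sets functions.
From mathcomp Require Import zify ring lra.

(* A modular pseudo-measure is determined by [F x = J(oo, x)], because
   [J(a, b) = F b * (F a)^-1].  Modularity under the translations
   [T^k : x |-> x + k] and under [sigma] reads
     [F (T^k x) = T^k (F x)]   and   [F (sigma x) = sigma (F x) * u]
   with [u = J(oo, 0)].  Euclid's algorithm reaches every point from [oo] by
   these moves, so [u] determines [J].  Conversely, given [u], the continued
   fraction recursion defines an [F] for which the first rule holds, and the
   second one holds on (0, 1).  The second rule at [x] is equivalent to the rule
   [F (tau y) = tau (F y) * u] at [y = x + 1]; the relation for [tau] shows that
   this rule holds on a whole [tau]-orbit once it holds at two of its points.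
   Combined with the relation for [sigma], this propagates the second rule to
   [-1, 0) by induction on the denominator, and then everywhere. *)

Set Implicit Arguments.
Unset Strict Implicit.
Unset Printing Implicit Defensive.

Import Order.TTheory GRing.Theory Num.Theory.

Local Open Scope ring_scope.

(** * Matrix identities in SL(2, Z) and generation by [sigma] and the translations *)

Lemma ord2P (i : 'I_2) : i = 0 \/ i = 1.
Proof. by case: i => [[|[|]]] // ?; [left | right]; apply/val_inj. Qed.

Lemma SL2Z_ext (g h : SL2Z) :
  g 0 0 = h 0 0 -> g 0 1 = h 0 1 -> g 1 0 = h 1 0 -> g 1 1 = h 1 1 -> g = h.
Proof.
move=> e00 e01 e10 e11; apply/val_inj/matrixP => i j /=.
by case: (ord2P i) => ->; case: (ord2P j) => ->.
Qed.

Lemma SL2Z_mulE (g h : SL2Z) i j :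
  (g * h)%g i j = g i 0 * h 0 j + g i 1 * h 1 j.
Proof. rewrite [LHS]mxE big_ord_recl big_ord1.
by have -> : lift ord0 ord0 = 1 :> 'I_2 by apply/val_inj.
Qed.

Lemma SL2Z_detE (g : SL2Z) : g 0 0 * g 1 1 - g 0 1 * g 1 0 = 1.
Proof.
rewrite -(SL2Z_det g) -det_mx2; congr (\det _); apply/matrixP => i j.
by case: (ord2P i) => ->; case: (ord2P j) => ->; rewrite mxE.
Qed.

Fact shift_subproof (k : int) : \det (mx2 1 k 0 1) == 1.
Proof. by rewrite det_mx2 mulr0 subr0 mulr1. Qed.

Definition shift (k : int) : SL2Z := MkSL2Z (shift_subproof k).

Lemma shiftE k : ((shift k 0 0 = 1) * (shift k 0 1 = k) *
  (shift k 1 0 = 0) * (shift k 1 1 = 1))%type.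
Proof. by do !split; rewrite mxE. Qed.

Lemma sigmaE : ((sigma 0 0 = 0) * (sigma 0 1 = -1) *
  (sigma 1 0 = 1) * (sigma 1 1 = 0))%type.
Proof. by do !split; rewrite mxE. Qed.

Lemma tauE : ((tau 0 0 = 0) * (tau 0 1 = -1) *
  (tau 1 0 = 1) * (tau 1 1 = -1))%type.
Proof. by do !split; rewrite mxE. Qed.

Lemma minusIE :
  ((minusI 0 0 = -1) * (minusI 0 1 = 0) *
   (minusI 1 0 = 0) * (minusI 1 1 = -1))%type.
Proof. by do !split; rewrite mxE. Qed.

Lemma SL2Z_oneE : (((1%g : SL2Z) 0 0 = 1) * ((1%g : SL2Z) 0 1 = 0) *
  ((1%g : SL2Z) 1 0 = 0) * ((1%g : SL2Z) 1 1 = 1))%type.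
Proof. by do !split; rewrite mxE. Qed.

Definition SL2Z_genE := (SL2Z_mulE, shiftE, sigmaE, tauE, minusIE, SL2Z_oneE).

Ltac SL2Z_ring := by apply: SL2Z_ext; rewrite !SL2Z_genE; ring.

Lemma sigma2 : (sigma * sigma)%g = minusI. Proof. SL2Z_ring. Qed.

Lemma tau3 : (tau * tau * tau = 1)%g. Proof. SL2Z_ring. Qed.

Lemma shift0 : shift 0 = 1%g. Proof. SL2Z_ring. Qed.

Lemma shiftD k l : (shift k * shift l)%g = shift (k + l). Proof. SL2Z_ring. Qed.

Lemma sigma_shiftN1 : (sigma * shift (-1))%g = tau. Proof. SL2Z_ring. Qed.

(* Euclid's algorithm on the first column. *)
Lemma SL2Z_gen_ind (P : SL2Z -> Prop) :
    P 1%g -> (forall k g, P g -> P (shift k * g)%g) ->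
    (forall g, P g -> P (sigma * g)%g) ->
  forall g, P g.
Proof.
move=> P1 Pshift Psigma g.
have [n] := ubnP `|(g 1 0)%R|%N; elim: n g => // n IHn g lt_g_n.
have detg := SL2Z_detE g.
have [c0|c_neq0] := eqVneq (g 1 0) 0.
  have ad1 : g 0 0 * g 1 1 = 1 by move: detg; rewrite c0 mulr0 subr0.
  have [[a1 d1]|[a1 d1]] : (g 0 0 = 1 /\ g 1 1 = 1) \/ (g 0 0 = -1 /\ g 1 1 = -1).
    have /eqP := congr1 absz ad1; rewrite abszM muln_eq1 => /andP[/eqP a1 /eqP d1].
    by lia.
  - have -> : g = (shift (g 0 1)%R * 1)%g.
      by apply: SL2Z_ext; rewrite !SL2Z_genE ?a1 ?d1 ?c0; ring.
    exact: Pshift.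
  (* Here the sign is absorbed by [sigma * sigma], which is $-I$. *)
  - have -> : g = (shift (- g 0 1)%R * (sigma * (sigma * 1)))%g.
      by apply: SL2Z_ext; rewrite !SL2Z_genE ?a1 ?d1 ?c0; ring.
    by apply/Pshift/Psigma/Psigma.
(* One division step: the translation reduces the top entry of the first column modulo the bottom
   one, and [sigma] then moves the remainder to the bottom. Undoing [sigma] takes three further
   factors, as it has order 4. *)
pose k := ((g 0 0)%R %/ (g 1 0)%R)%Z; pose h := (sigma * (shift (- k) * g))%g.
have -> : g = (shift k * (sigma * (sigma * (sigma * h))))%g.
  rewrite /h; SL2Z_ring.
apply/Pshift/Psigma/Psigma/Psigma/IHn.
have -> : h 1 0 = ((g 0 0)%R %% (g 1 0)%R)%Z.
  by rewrite /h !SL2Z_genE /modz -/k; ring.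
have := modz_ge0 (g 0 0) c_neq0; have := ltz_mod (g 0 0) c_neq0.
lia.
Qed.

(** * The fractional linear action in homogeneous coordinates *)

Lemma moebius_ratio (g : SL2Z) (p q : rat) : (p, q) != (0, 0) ->
  moebius g (P1Q_ratio p q) =
  P1Q_ratio ((g 0 0)%:~R * p + (g 0 1)%:~R * q) ((g 1 0)%:~R * p + (g 1 1)%:~R * q).
Proof.
rewrite /P1Q_ratio xpair_eqE; have [->|q0] /= := eqVneq q 0.
  rewrite andbT => p0; rewrite !mulr0 !addr0 mulf_eq0 (negPf p0) orbF /P1Q_ratio.
  case: eqVneq => // c0; congr Some; field.
  by rewrite c0 p0.
move=> _; rewrite /P1Q_ratio.
have e : (g 1 0)%:~R * (p / q) + (g 1 1)%:~R =
   ((g 1 0)%:~R * p + (g 1 1)%:~R * q) / q by field.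
rewrite e mulf_eq0 invr_eq0 (negPf q0) orbF; case: eqVneq => // d0.
by congr Some; field; rewrite d0 q0.
Qed.

Lemma ratio_finite (x : rat) : Some x = P1Q_ratio x 1.
Proof. by rewrite /P1Q_ratio oner_eq0 divr1. Qed.

Lemma ratio_infty : infty = P1Q_ratio 1 0.
Proof. by rewrite /P1Q_ratio eqxx. Qed.

Lemma P1Q_ratioP (x : P1Q) : exists p q, (p, q) != (0, 0) /\ x = P1Q_ratio p q.
Proof.
case: x => [x|]; last by exists 1, 0; rewrite -ratio_infty xpair_eqE oner_eq0.
by exists x, 1; rewrite -ratio_finite xpair_eqE oner_eq0 andbF.
Qed.

Lemma moebius1 x : moebius 1%g x = x.
Proof.
have [p [q [pq0 ->]]] := P1Q_ratioP x.
by rewrite moebius_ratio // !SL2Z_genE !mul1r !mul0r addr0 add0r.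
Qed.

Lemma moebiusM g h x : moebius (g * h)%g x = moebius g (moebius h x).
Proof.
have [p [q [pq0 ->]]] := P1Q_ratioP x.
rewrite !moebius_ratio //; last first.
  (* The vector [h (p, q)] is nonzero: applying the adjugate of [h], whose determinant is 1, would
     otherwise give [p = q = 0]. *)
  apply: contra_neq pq0 => -[e1 e2].
  have := congr1 (intmul (1 : rat)) (SL2Z_detE h).
  rewrite rmorphB !rmorphM /= mulr1z => detQ.
  congr (_, _).
    rewrite -[p]mul1r -detQ.
    transitivity ((h 1 1)%:~R * ((h 0 0)%:~R * p + (h 0 1)%:~R * q)
      - (h 0 1)%:~R * ((h 1 0)%:~R * p + (h 1 1)%:~R * q)); first by ring.
    by rewrite e1 e2 !mulr0 subr0.
  rewrite -[q]mul1r -detQ.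
  transitivity ((h 0 0)%:~R * ((h 1 0)%:~R * p + (h 1 1)%:~R * q)
      - (h 1 0)%:~R * ((h 0 0)%:~R * p + (h 0 1)%:~R * q)); first by ring.
  by rewrite e1 e2 !mulr0 subr0.
by rewrite !SL2Z_mulE !rmorphD !rmorphM /=; congr P1Q_ratio; ring.
Qed.

Lemma moebius_shift_infty k : moebius (shift k) infty = infty.
Proof. by rewrite /= !SL2Z_genE /P1Q_ratio eqxx. Qed.

Lemma moebius_shift k x : moebius (shift k) (Some x) = Some (x + k%:~R).
Proof. by rewrite /= !SL2Z_genE /P1Q_ratio mul0r add0r oner_eq0 mul1r divr1. Qed.

Lemma moebius_sigma_infty : moebius sigma infty = Some 0.
Proof. by rewrite /= !SL2Z_genE /P1Q_ratio oner_eq0 divr1. Qed.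

Lemma moebius_sigma0 : moebius sigma (Some 0) = infty.
Proof. by rewrite /= !SL2Z_genE /P1Q_ratio mulr0 addr0 eqxx. Qed.

Lemma moebius_sigma x : x != 0 -> moebius sigma (Some x) = Some (- x^-1).
Proof.
move=> x0; rewrite /= !SL2Z_genE /P1Q_ratio mul1r addr0 (negPf x0).
by rewrite mul0r add0r mulN1r.
Qed.

Lemma moebius_minusI x : moebius minusI x = x.
Proof.
have [p [q [pq0 ->]]] := P1Q_ratioP x.
rewrite moebius_ratio // !SL2Z_genE !mulN1r !mul0r addr0 add0r.
by rewrite /P1Q_ratio oppr_eq0; case: eqVneq => // q0; congr Some; field.
Qed.

Lemma moebius_sigmaK x : moebius sigma (moebius sigma x) = x.
Proof. by rewrite -moebiusM sigma2 moebius_minusI. Qed.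

Lemma moebius_tau1 : moebius tau (Some 1) = infty.
Proof. by rewrite -sigma_shiftN1 moebiusM moebius_shift subrr moebius_sigma0. Qed.

Lemma moebius_tau_infty : moebius tau infty = Some 0.
Proof.
by rewrite -sigma_shiftN1 moebiusM moebius_shift_infty moebius_sigma_infty.
Qed.

Lemma moebius_tau x : x != 1 -> moebius tau (Some x) = Some (- (x - 1)^-1).
Proof.
move=> x1; rewrite -sigma_shiftN1 moebiusM moebius_shift moebius_sigma //.
by rewrite subr_eq0.
Qed.

(** * Denominator bounds and induction along continued fractions *)

(* The fraction need not be in lowest terms. *)
Definition has_denom (n : nat) (x : rat) : Prop :=
  exists p q : int, [/\ 0 < q, q <= n%:Z & x = p%:~R / q%:~R].

Lemma has_denom_denq x : has_denom `|denq x| x.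
Proof.
exists (numq x), (denq x); split => //; last by rewrite divq_num_den.
by have := denq_gt0 x; lia.
Qed.

Lemma has_denom_ex x : exists n, has_denom n x.
Proof. by exists `|denq x|%N; exact: has_denom_denq. Qed.

Lemma has_denom0 x : ~ has_denom 0 x.
Proof. by case=> p [q [q0 q1 _]]; lia. Qed.

Lemma has_denom_fract n x : has_denom n x -> has_denom n (x - (Num.floor x)%:~R).
Proof.
case=> p [q [q0 qn ->]]; set k := Num.floor _.
exists (p - k * q), q; split => //; rewrite rmorphB rmorphM /=; field.
by rewrite intr_eq0 gt_eqF.
Qed.

Lemma has_denom_itv01 n x : 0 < x < 1 -> has_denom n x ->
  exists p q : int, [/\ 0 < p, p < q, q <= n%:Z & x = p%:~R / q%:~R].
Proof.
move=> /andP[x0 x1] [p [q [q0 qn xE]]]; exists p, q.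
have q0' : 0 < q%:~R :> rat by rewrite ltr0z.
split=> //; last by move: x1; rewrite xE ltr_pdivrMr // mul1r ltr_int.
by move: x0; rewrite xE pmulr_lgt0 ?invr_gt0 // ltr0z.
Qed.

(** The numerator [p < q] becomes the denominator; this strict drop makes the continued fraction
    recursion terminate. *)
Lemma has_denom_inv n x : 0 < x < 1 -> has_denom n.+1 x -> has_denom n (- x^-1).
Proof.
move=> x01 /(has_denom_itv01 x01)[p [q [p0 pq qn ->]]].
exists (- q), p; split => //; first by lia.
by rewrite rmorphN /=; field; rewrite !intr_eq0; lia.
Qed.

(** The new denominator is [q - p < q]; this is the descent used in [sigma_rule_neg]. *)
Lemma has_denom_divB n x :
  0 < x < 1 -> has_denom n.+1 x -> has_denom n (x / (1 - x)).
Proof.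
move=> x01 /(has_denom_itv01 x01)[p [q [p0 pq qn ->]]].
exists p, (q - p); split; [by lia | by lia |].
rewrite rmorphB /=; field.
by rewrite -rmorphB /= !intr_eq0; lia.
Qed.

Lemma fract_itv (x : rat) : 0 <= x - (Num.floor x)%:~R < 1.
Proof. by have := floor_itv x; rewrite rmorphD /= => ?; lra. Qed.

Lemma P1Q_gen_ind (P : P1Q -> Prop) :
    P infty -> (forall k x, P x -> P (moebius (shift k) x)) ->
    (forall x, P x -> P (moebius sigma x)) ->
  forall x, P x.
Proof.
move=> Poo Pshift Psigma [x|] //; have [n] := has_denom_ex x.
elim: n x => [|n IHn] x xn; first by case: (has_denom0 xn).
set y := x - (Num.floor x)%:~R.
have -> : Some x = moebius (shift (Num.floor x)) (Some y).
  by rewrite moebius_shift subrK.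
apply: Pshift; have [->|y0] := eqVneq y 0.
  by rewrite -moebius_sigma_infty; exact: Psigma.
rewrite -[Some y]moebius_sigmaK moebius_sigma //; apply/Psigma/IHn.
apply: has_denom_inv; last exact: has_denom_fract.
by have := fract_itv x; rewrite -/y; lra.
Qed.

(** * Construction of a modular pseudo-measure from [u] *)

Section Potential.
Variables (V : groupType) (act : group_action SL2Z V) (u : V).
Hypothesis act_minusI : forall v, act minusI v = v.
Hypothesis u_sigma : (act sigma u * u = 1)%g.
Hypothesis u_tau : (act (tau ^+ 2) u * act tau u * u = 1)%g.

(* The candidate for [J(oo, x)], along the continued fraction of [x]; the
   value is only meaningful when [has_denom n x]. *)
Fixpoint potential_rec (n : nat) (x : rat) : V :=
  if n isn't n'.+1 then 1%g else
  let y := x - (Num.floor x)%:~R in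
  act (shift (Num.floor x))
    (if y == 0 then u else act sigma (potential_rec n' (- y^-1)) * u)%g.

Definition potential (x : P1Q) : V :=
  if x is Some t then potential_rec `|denq t|%N t else 1%g.

(** Both computations follow the same continued fraction, and a valid denominator bound ensures that
    they stop at [y == 0] before the fuel runs out. *)
Lemma potential_rec_stable n m x : has_denom n x -> has_denom m x ->
  potential_rec n x = potential_rec m x.
Proof.
elim: n m x => [|n IHn] [|m] x xn xm;
  try by [case: (has_denom0 xn) | case: (has_denom0 xm)].
rewrite /=; case: eqVneq => // y0.
have y01 : 0 < x - (Num.floor x)%:~R < 1 by have := fract_itv x; lra.
by rewrite (IHn m) //; apply: has_denom_inv => //; apply: has_denom_fract.
Qed.

Lemma potentialE n x : has_denom n x -> potential (Some x) = potential_rec n x.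
Proof. by apply: potential_rec_stable; exact: has_denom_denq. Qed.

Lemma potential_int k : potential (Some k%:~R) = act (shift k) u.
Proof.
rewrite (@potentialE 1); last by exists k, 1; rewrite divr1.
by rewrite /= intrKfloor subrr eqxx.
Qed.

Lemma potential0 : potential (Some 0) = u.
Proof. by rewrite -[0]/(0%:~R) potential_int shift0 gact1. Qed.

Lemma potential_shift k x :
  potential (moebius (shift k) x) = act (shift k) (potential x).
Proof.
case: x => [x|]; last by rewrite moebius_shift_infty /= gact_g1.
rewrite moebius_shift; have [n [p [q [q0 qn xE]]]] := has_denom_ex x.
case: n qn => [|n] qn; first by lia.
have xn : has_denom n.+1 x by exists p, q.
have xkn : has_denom n.+1 (x + k%:~R).
  exists (p + k * q), q; split => //.
  by rewrite xE rmorphD rmorphM /=; field; rewrite intr_eq0 gt_eqF.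
rewrite (potentialE xn) (potentialE xkn).
rewrite /= floorDrz ?intr_int // intrKfloor rmorphD /=.
have -> : x + k%:~R - ((Num.floor x)%:~R + k%:~R) = x - (Num.floor x)%:~R by ring.
by rewrite [_ + k]addrC -shiftD gactM.
Qed.

Lemma act_sigmaK v : act sigma (act sigma v) = v.
Proof. by rewrite -gactM sigma2 act_minusI. Qed.

Let sigma_rule x := potential (moebius sigma x) = (act sigma (potential x) * u)%g.

(** Apply [sigma] to the rule at [x]: as [sigma] acts on values as an involution, the extra factor
    is [act sigma u], which [u_sigma] cancels against [u]. *)
Let sigma_rule_sigma x : sigma_rule x -> sigma_rule (moebius sigma x).
Proof.
rewrite /sigma_rule => ->; rewrite moebius_sigmaK gact_morph act_sigmaK.
by rewrite -mulgA u_sigma mulg1.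
Qed.

Let sigma_rule_infty : sigma_rule infty.
Proof. by rewrite /sigma_rule moebius_sigma_infty potential0 /= gact_g1 mul1g. Qed.

(** For floor 0, one unfolding of [potential_rec] is literally the rule at $-1/x$, and
    [sigma_rule_sigma] carries it over to [x]. *)
Let sigma_rule_unit x : 0 < x < 1 -> sigma_rule (Some x).
Proof.
move=> x01; rewrite -[Some x]moebius_sigmaK; apply: sigma_rule_sigma.
have x0 : x != 0 by lra.
rewrite /sigma_rule moebius_sigmaK moebius_sigma //.
have [[|n] xn] := has_denom_ex x; first by case: (has_denom0 xn).
rewrite (potentialE xn) (potentialE (has_denom_inv x01 xn)) /=.
have -> : Num.floor x = 0 by apply: floor_def; rewrite add0r; lra.
by rewrite subr0 (negPf x0) shift0 gact1.
Qed.

Let tau_rule x := potential (moebius tau x) = (act tau (potential x) * u)%g.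

Let tau_rule_shift x : sigma_rule x <-> tau_rule (moebius (shift 1) x).
Proof.
have sE : sigma = (tau * shift 1)%g by SL2Z_ring.
by rewrite /tau_rule /sigma_rule potential_shift -moebiusM -gactM -sE.
Qed.

Let tau_rule_1 x : sigma_rule (Some (x - 1)) <-> tau_rule (Some x).
Proof. by rewrite tau_rule_shift moebius_shift subrK. Qed.

(** Chaining the two rules, and writing $F$ for [potential], the right-hand side becomes
    $\tau^3[F(x)]\,\tau^2[u]\,\tau[u]\,u$, which is $F(x) = F(\tau^3 x)$ by [u_tau]. *)
Let tau_rule_tau x :
  tau_rule x -> tau_rule (moebius tau x) ->
  tau_rule (moebius tau (moebius tau x)).
Proof.
rewrite /tau_rule => e1 e2.
rewrite e2 e1 -!moebiusM tau3 moebius1 !gact_morph -!gactM.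
rewrite tau3 gact1 -2!mulgA [X in (_ * X)%g]mulgA -expg2.
by rewrite u_tau mulg1.
Qed.

Let sigma_rule_N1 : sigma_rule (Some (-1)).
Proof.
rewrite -[-1]sub0r.
(* The [tau]-orbit is $1 \to \infty \to 0$; the rules at $1$ and $\infty$ come from the [sigma] rule
   at $0 = \sigma\infty$ and at $\infty$. *)
apply/(tau_rule_1 0); rewrite -moebius_tau_infty -moebius_tau1; apply: tau_rule_tau.
  by apply/tau_rule_1; rewrite subrr -moebius_sigma_infty; exact: sigma_rule_sigma.
by rewrite moebius_tau1 -(moebius_shift_infty 1); apply/tau_rule_shift.
Qed.

Let sigma_rule_neg n s : has_denom n s -> 0 < s <= 1 -> sigma_rule (Some (- s)).
Proof.
elim: n s => [s /has_denom0 //|n IHn] s sn /andP[s0 s1].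
have [->|s_neq1] := eqVneq s 1; first exact: sigma_rule_N1.
have {}s1 : s < 1 by rewrite lt_neqAle s_neq1.
have -> : - s = (1 - s) - 1 by ring.
apply/tau_rule_1.
have tau1 : moebius tau (Some (1 - s)) = Some s^-1.
  by rewrite moebius_tau; [congr Some; field; lra | lra].
(* The [tau]-orbit of $1-s$ continues with $1/s$ and $-s/(1-s)$. Shifted back by 1, these two points
   call for the [sigma] rule at $1/s-1$ and at $-1/(1-s)$. *)
rewrite -[Some (1 - s)]moebius1 -tau3 !moebiusM.
apply: tau_rule_tau; rewrite tau1.
  apply/tau_rule_1.
  have w0 : 0 < s^-1 - 1 by rewrite subr_gt0 invf_gt1.
  have [w1|w1] := ltP (s^-1 - 1) 1; first by apply: sigma_rule_unit; rewrite w0.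
  (* When $1/s-1 \ge 1$, its image under [sigma] is $-s/(1-s)$, which lies in $[-1,0)$ and has a
     smaller denominator than $s$. *)
  rewrite -[Some (_ - _)]moebius_sigmaK; apply: sigma_rule_sigma.
  rewrite moebius_sigma ?gt_eqF //; apply: IHn.
    have -> : (s^-1 - 1)^-1 = s / (1 - s) by field; lra.
    by apply: has_denom_divB => //; rewrite s0.
  by rewrite invr_gt0 w0 invf_le1.
rewrite moebius_tau; last by rewrite invr_eq1.
apply/tau_rule_1; have -> : - (s^-1 - 1)^-1 - 1 = - (1 - s)^-1 by field; lra.
rewrite -moebius_sigma; last by lra.
by apply/sigma_rule_sigma/sigma_rule_unit; lra.
Qed.

Lemma potential_sigma x :
  potential (moebius sigma x) = (act sigma (potential x) * u)%g.
Proof.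
rewrite -/(sigma_rule x); case: x => [x|]; last exact: sigma_rule_infty.
have sigma_rule_neg' y : -1 <= y < 0 -> sigma_rule (Some y).
  move=> y01; rewrite -[y]opprK; have [n yn] := has_denom_ex (- y).
  by apply: sigma_rule_neg yn _; lra.
have [->|x0] := eqVneq x 0.
  by rewrite -moebius_sigma_infty; exact: sigma_rule_sigma.
have [x01|x01] := boolP (-1 <= x < 1).
  have [lt_x0|le_0x] := ltP x 0; first by apply: sigma_rule_neg'; lra.
  by apply: sigma_rule_unit; lra.
(* Outside $[-1,1)$, [sigma] sends $x<-1$ into $(0,1)$ and $x\ge 1$ into $[-1,0)$. *)
rewrite -[Some x]moebius_sigmaK moebius_sigma //; apply: sigma_rule_sigma.
have [lt_x0|le_0x] := ltP x 0.
  apply: sigma_rule_unit; rewrite -invrN invr_gt0 invf_lt1; lra.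
by apply: sigma_rule_neg'; rewrite lerN2 invf_le1 ?oppr_lt0 ?invr_gt0; lra.
Qed.

Definition potential_diff (a b : P1Q) : V := (potential b * (potential a)^-1)%g.

Lemma potential_diff_pseudo_measure : pseudo_measure potential_diff.
Proof.
split=> [a|a b|a b c]; rewrite /potential_diff ?mulgV //.
  by rewrite mulgA mulgVK mulgV.
by rewrite !mulgA !mulgVK mulgV.
Qed.

(** It suffices to check the generators. Under [sigma] both potentials acquire the same right factor
    [u], which cancels in the quotient. *)
Lemma potential_diff_modular : modular act potential_diff.
Proof.
elim/SL2Z_gen_ind => [|k g IHg|g IHg] a b; first by rewrite !moebius1 gact1.
  by rewrite !moebiusM gactM -IHg /potential_diff !potential_shift gact_morph gactV.
rewrite !moebiusM gactM -IHg /potential_diff !potential_sigma gact_morph gactV.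
by rewrite invgM mulgA mulgK.
Qed.

Lemma potential_diff_infty0 : potential_diff infty (Some 0) = u.
Proof. by rewrite /potential_diff potential0 invg1 mulg1. Qed.

End Potential.

(** * Relations satisfied by the values of a modular pseudo-measure *)

Section ModularPseudoMeasures.
Variables (U : groupType) (act : group_action SL2Z U) (J : P1Q -> P1Q -> U).
Hypothesis J_modular : modular_pseudo_measures act J.

Let JJ a b c : (J b c * J a b = J a c)%g.
Proof.
have [[_ JV J3] _] := J_modular.
apply: (mulgI (J c a)); rewrite JV mulgA; exact: J3.
Qed.

Let actJ g a b : act g (J a b) = J (moebius g a) (moebius g b).
Proof. by have [_ ->] := J_modular. Qed.

Lemma modular_infty0_fixed : act minusI (J infty (Some 0)) = J infty (Some 0).
Proof. by rewrite actJ !moebius_minusI. Qed.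

(** Since [sigma] swaps $\infty$ and $0$, the product runs along the segment and back. *)
Lemma modular_infty0_sigma :
  (act sigma (J infty (Some 0)) * J infty (Some 0) = 1)%g.
Proof.
rewrite actJ moebius_sigma_infty moebius_sigma0 JJ.
by have [[-> _ _] _] := J_modular.
Qed.

(** Since [tau] permutes $\infty \to 0 \to 1 \to \infty$, the product runs once around this
    triangle. *)
Lemma modular_infty0_tau :
  (act (tau ^+ 2) (J infty (Some 0)) * act tau (J infty (Some 0)) *
     J infty (Some 0) = 1)%g.
Proof.
have tau0 : moebius tau (Some 0) = Some 1.
  by rewrite moebius_tau // sub0r invrN invr1 opprK.
rewrite expg2 !actJ !moebiusM moebius_tau_infty tau0 moebius_tau1 !JJ.
by have [[-> _ _] _] := J_modular.
Qed.

Lemma modular_shift k x : J infty (moebius (shift k) x) = act (shift k) (J infty x).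
Proof. by rewrite actJ moebius_shift_infty. Qed.

Lemma modular_sigma x :
  J infty (moebius sigma x) = (act sigma (J infty x) * J infty (Some 0))%g.
Proof. by rewrite actJ moebius_sigma_infty JJ. Qed.

Lemma pseudo_measure_infty a b : J a b = (J infty b * (J infty a)^-1)%g.
Proof. by apply: (mulIg (J infty a)); rewrite JJ mulgVK. Qed.

End ModularPseudoMeasures.

(** * Injectivity and the bijection *)

Lemma modular_pseudo_measure_inj (U : groupType) (act : group_action SL2Z U) J K :
    modular_pseudo_measures act J -> modular_pseudo_measures act K ->
  J infty (Some 0) = K infty (Some 0) -> J = K.
Proof.
move=> Jmod Kmod JK0; suff JK x : J infty x = K infty x.
  apply/funext => a; apply/funext => b.
  by rewrite (pseudo_measure_infty Jmod) (pseudo_measure_infty Kmod) !JK.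
elim/P1Q_gen_ind: x => [|k x IHx|x IHx].
- by have [[-> _ _] _] := Jmod; have [[-> _ _] _] := Kmod.
- by rewrite (modular_shift Jmod) (modular_shift Kmod) IHx.
- by rewrite (modular_sigma Jmod) (modular_sigma Kmod) IHx JK0.
Qed.

Local Open Scope classical_set_scope.

Theorem theorem4p7 (U : groupType) (act : group_action SL2Z U) :
  set_bij (modular_pseudo_measures act)
    [set U_plus_val u | u in phi act @^-1` [set (1%g, 1%g)]]
    (fun J => J infty (P1Q_of_rat 0%R)).
Proof.
split=> [J Jmod|J K /set_mem Jmod /set_mem Kmod|v [u phi_u <-]].
- have J_fixed : J infty (Some 0) \in fix_minusI act.
    by apply/fix_minusIP; exact: modular_infty0_fixed.
  exists (MkUPlus J_fixed) => //; congr (_, _); apply/val_inj.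
    exact: (modular_infty0_sigma Jmod).
  exact: (modular_infty0_tau Jmod).
- exact: (modular_pseudo_measure_inj Jmod Kmod).
(* The construction needs $-I$ to act trivially, so it is carried out in [U_plus] and then composed
   with the inclusion into [U]. *)
- pose D := potential_diff (gact_plus act) u.
  have [D1 D2 D3] : pseudo_measure D by exact: potential_diff_pseudo_measure.
  have Dmod : modular (gact_plus act) D.
    exact: (potential_diff_modular (@gact_plus_minusI _ act)
      (congr1 fst phi_u) (congr1 snd phi_u)).
  exists (fun a b => U_plus_val (D a b)); last first.
    by rewrite /D potential_diff_infty0.
  split; first split.
  - by move=> a; rewrite D1.
  - by move=> a b; have := congr1 val (D2 a b).
  - by move=> a b c; have := congr1 val (D3 a b c).
  - by move=> g a b; rewrite Dmod.
Qed.
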